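(* Let $\{(\lambda_{i;j},u_{i;j})\}_{j\ge 0}$ be the sequence generated by the PSD-id method for the $i$th eigenpair of $(H,S)$ with preconditioners $K_{i;j}$. Suppose that $\lambda_i<\lambda_{i;0}<\lambda_{i+1}$, that $K_{i;j}$ is effectively positive definite for every $j$ (i.e. $K^c_{i;j}=(U_{i-1}^c)^H S K_{i;j} S U_{i-1}^c$ is Hermitian positive definite), and that $\sup_j \kappa(K^c_{i;j})=q<\infty$. Then $(\lambda_{i;j},u_{i;j})$ converges to $(\lambda_i,u_i)$, i.e. (a) $\lim_{j\to\infty}\lambda_{i;j}=\lambda_i$; (b) $\lim_{j\to\infty}\|r_{i;j}\|_{S^{-1}}=0$, where $r_{i;j}=Hu_{i;j}-\lambda_{i;j}Su_{i;j}$; namely, $u_{i;j}$ converges to $u_i$ directionally.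
   Context: $H,S\in\mathbb{C}^{n\times n}$ are Hermitian and $S$ is positive definite. The eigenpairs of $Hu=\lambda Su$ are $(\lambda_k,u_k)$, $k=1,\dots,n$, with $\lambda_1\le\cdots\le\lambda_n$ and $U=[u_1\ \cdots\ u_n]$ satisfying $U^HSU=I$. Write $U_{i-1}=[u_1\ \cdots\ u_{i-1}]$ (empty if $i=1$) and $U_{i-1}^c=[u_i\ \cdots\ u_n]$. The index $i$ is fixed with $1\le i\le n-1$, and it is assumed that $\lambda_{i-1}<\lambda_i<\lambda_{i+1}$ (the first inequality is void if $i=1$). The Rayleigh quotient is $\rho(z)=z^HHz/(z^HSz)$; $\|x\|_S=\sqrt{x^HSx}$, $\|x\|_{S^{-1}}=\sqrt{x^HS^{-1}x}$; $\kappa(\cdot)$ is the spectral-norm condition number. PSD-id method (preconditioned steepest descent with implicit deflation): $U_{i-1}$ is known, and the initial vector $u_{i;0}$ satisfies $U_{i-1}^HSu_{i;0}=0$, $\|u_{i;0}\|_S=1$, with $\lambda_{i;0}=\rho(u_{i;0})$. For $j=0,1,2,\dots$: compute $r_{i;j}=Hu_{i;j}-\lambda_{i;j}Su_{i;j}$ and $p_{i;j}=-K_{i;j}r_{i;j}$, where $K_{i;j}\in\mathbb{C}^{n\times n}$ is a preconditioner that may change with $j$; set $Z_j=[U_{i-1}\ u_{i;j}\ p_{i;j}]$ and let $(\gamma_i,w_i)$ be the $i$th eigenpair (eigenvalues in ascending order) of the pair $(H_R,S_R)=(Z_j^HHZ_j,Z_j^HSZ_j)$, normalized by $w_i^HS_Rw_i=1$;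 set $\lambda_{i;j+1}=\gamma_i$ and $u_{i;j+1}=Z_jw_i$. It is assumed that the method does not break down, i.e. $Z_j$ has full column rank for every $j$, so that an infinite sequence is produced. ''Converges to $u_i$ directionally'' means that there are scalars $c_j$ with $|c_j|=1$ such that $c_ju_{i;j}\to u_i$. *)

(* Defs.v *)
From HB Require Import structures.
From mathcomp Require Import all_boot all_order all_algebra.
From mathcomp Require Import all_classical all_reals all_analysis.
From mathcomp Require Import complex.

Set Implicit Arguments.
Unset Strict Implicit.
Unset Printing Implicit Defensive.

Import Order.TTheory GRing.Theory Num.Theory numFieldNormedType.Exports.

Local Open Scope classical_set_scope.
Local Open Scope ring_scope.
Local Open Scope sesquilinear_scope.
Local Open Scope complex_scope.

(* [0 < z] on [R[i]] means that [z] is real and positive. *)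
Definition hpd (R : realType) (n : nat) (S : 'M[R[i]]_n) : Prop :=
  S \is hermsymmx /\
  forall x : 'cV[R[i]]_n, x != 0 -> 0 < (x ^t* *m S *m x) 0 0.

Definition rayleigh (R : realType) (n : nat) (H S : 'M[R[i]]_n)
    (z : 'cV[R[i]]_n) : R[i] :=
  (z ^t* *m H *m z) 0 0 / (z ^t* *m S *m z) 0 0.

(* The real part loses nothing when [S] is Hermitian. *)
Definition enorm (R : realType) (n : nat) (S : 'M[R[i]]_n)
    (x : 'cV[R[i]]_n) : R :=
  Num.sqrt (complex.Re ((x ^t* *m S *m x) 0 0)).

Definition norm2 (R : realType) (n : nat) (x : 'cV[R[i]]_n) : R :=
  enorm 1%:M x.

Definition specnorm (R : realType) (n : nat) (A : 'M[R[i]]_n) : R :=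
  sup [set norm2 (A *m x) | x in [set x : 'cV[R[i]]_n | norm2 x <= 1]].

Definition cond2 (R : realType) (n : nat) (A : 'M[R[i]]_n) : R :=
  specnorm A * specnorm (invmx A).

(* All the eigenpairs [(lam k, col k U)] of [H u = lambda S u], in ascending
   order and [S]-orthonormalized. *)
Definition eigensystem (R : realType) (n : nat) (H S : 'M[R[i]]_n)
    (lam : 'I_n -> R) (U : 'M[R[i]]_n) : Prop :=
  [/\ forall k : 'I_n, H *m col k U = (lam k)%:C *: (S *m col k U),
      U ^t* *m S *m U = 1%:M
    & forall k l : 'I_n, (k <= l)%N -> lam k <= lam l].

(* The eigenvector is normalized; if [gam] is a multiple eigenvalue, any
   normalized eigenvector for it qualifies. *)
Definition kth_eigenpair (R : realType) (n : nat) (H S : 'M[R[i]]_n)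
    (k : 'I_n) (gam : R) (w : 'cV[R[i]]_n) : Prop :=
  exists (lam : 'I_n -> R) (W : 'M[R[i]]_n),
    [/\ eigensystem H S lam W, lam k = gam & col k W = w].

(* Indices are zero-based: [i : 'I_n] stands for the (i+1)-st index, so that
   exactly [i] columns of [U] precede [col i U]. *)
Definition Uprev (R : realType) (n : nat) (i : 'I_n) (U : 'M[R[i]]_n) :
    'M[R[i]]_(n, i) :=
  colsub (widen_ord (ltnW (ltn_ord i))) U.

Definition Ucompl (R : realType) (n : nat) (i : 'I_n) (U : 'M[R[i]]_n) :
    'M[R[i]]_(n, n - i) :=
  colsub (fun k : 'I_(n - i) =>
            cast_ord (subnKC (ltnW (ltn_ord i))) (rshift i k)) U.

Definition residual (R : realType) (n : nat) (H S : 'M[R[i]]_n)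
    (mu : R) (u : 'cV[R[i]]_n) : 'cV[R[i]]_n :=
  H *m u - mu%:C *: (S *m u).

Definition trial_basis (R : realType) (n : nat) (i : 'I_n)
    (H S K U : 'M[R[i]]_n) (mu : R) (u : 'cV[R[i]]_n) :
    'M[R[i]]_(n, i + (1 + 1)) :=
  row_mx (Uprev i U) (row_mx u (- (K *m residual H S mu u))).

(* [(lamj, u)] is an infinite run, without breakdown, of the preconditioned
   steepest descent method with implicit deflation. The Ritz pair kept at each
   step is the one at the (zero-based) position [i], which is also the position
   of [u j] among the columns of the trial basis. *)
Definition psd_id (R : realType) (n : nat) (i : 'I_n) (H S U : 'M[R[i]]_n)
    (K : nat -> 'M[R[i]]_n) (lamj : nat -> R) (u : nat -> 'cV[R[i]]_n) :
    Prop :=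
  [/\ (Uprev i U) ^t* *m S *m u 0%N = 0,
      enorm S (u 0%N) = 1,
      (lamj 0%N)%:C = rayleigh H S (u 0%N)
    & forall j : nat,
        let Z := trial_basis i H S (K j) U (lamj j) (u j) in
        \rank Z = (i + (1 + 1))%N /\
        exists w : 'cV[R[i]]_(i + (1 + 1)),
          kth_eigenpair (Z ^t* *m H *m Z) (Z ^t* *m S *m Z)
            (rshift i (lshift 1 (ord0 : 'I_1))) (lamj j.+1) w /\
          u j.+1 = Z *m w].

Definition Kcompl (R : realType) (n : nat) (i : 'I_n) (S U K : 'M[R[i]]_n) :
    'M[R[i]]_(n - i) :=
  (Ucompl i U) ^t* *m S *m K *m S *m Ucompl i U.

Definition eff_posdef (R : realType) (n : nat) (i : 'I_n)
    (S U K : 'M[R[i]]_n) : Prop :=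
  hpd (Kcompl i S U K).

(* The regular module [R[i]^o] carries the usual topology of [R[i]]. *)
Definition converges_directionally (R : realType) (n : nat)
    (u : nat -> 'cV[R[i]]_n) (v : 'cV[R[i]]_n) : Prop :=
  exists c : nat -> R[i],
    (forall j, `|c j| = 1) /\
    (fun j => c j *: u j : 'cV[R[i]^o]_n) @ \oo --> (v : 'cV[R[i]^o]_n).

(* Main.v *)
(* Deflation reduces everything to the coordinates [x = Uc^* S u] on the
   complement [Uc = U_{i-1}^c]: there [S] becomes the identity, [H] a diagonal
   matrix [D], the residual [S Uc g] with [g = D x - mu x], and the search
   direction [- K^c g]. The Ritz value at position [i] is the minimum of the
   Rayleigh quotient over the span of [x] and [K^c g]. Testing it on
   [x - t K^c g] with the step [t = 1 / (L a^2 b)], where [a] and [b] are the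
   spectral norms of [K^c] and of its inverse and [L] bounds the spread of [D],
   gives [|g|^2 <= 4 L q^2 (mu_j - mu_{j+1})]. The [mu_j] decrease and are
   bounded below, so [g -> 0]. As [mu_j <= mu_0 < lambda_{i+1}], each
   coordinate of [x] other than the first is controlled by [|g|], hence tends
   to [0], and [mu_j -> lambda_i] follows. *)
Require Import Defs.
From HB Require Import structures.
From mathcomp Require Import all_boot all_order all_algebra.
From mathcomp Require Import all_classical all_reals all_analysis.
From mathcomp Require Import complex.
From mathcomp Require Import ring lra.

Set Implicit Arguments.
Unset Strict Implicit.
Unset Printing Implicit Defensive.

Import Order.TTheory GRing.Theory Num.Theory numFieldNormedType.Exports.

Local Open Scope classical_set_scope.
Local Open Scope ring_scope.
Local Open Scope complex_scope.

(** * Real inner product and Hermitian matrices *)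

Section AdjointMatrix.
Local Open Scope sesquilinear_scope.
Variable R : realType.
Local Notation C := R[i].

Lemma conjE (z : C) : Num.conj z = (complex.Re z) -i* (complex.Im z).
Proof. by case: z. Qed.

Lemma conj_real_complex (t : R) : Num.conj (t%:C : C) = t%:C.
Proof. by rewrite conjE /= oppr0. Qed.

Lemma ReD (z w : C) : complex.Re (z + w) = complex.Re z + complex.Re w.
Proof. by case: z; case: w. Qed.

Lemma ReN (z : C) : complex.Re (- z) = - complex.Re z.
Proof. by case: z. Qed.

Lemma ReZ (t : R) (z : C) : complex.Re (t%:C * z) = t * complex.Re z.
Proof. by case: z => a b /=; rewrite mul0r subr0. Qed.

Lemma Re_conj (z : C) : complex.Re (Num.conj z) = complex.Re z.
Proof. by rewrite conjE. Qed.

Lemma Re_sum (I : finType) (F : I -> C) :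
  complex.Re (\sum_k F k) = \sum_k complex.Re (F k).
Proof. exact: (big_morph (@complex.Re R) ReD). Qed.

Lemma adjM m n p (A : 'M[C]_(m, n)) (B : 'M[C]_(n, p)) :
  (A *m B)^t* = B^t* *m A^t*.
Proof. by rewrite trmx_mul map_mxM. Qed.

Lemma adj1 n : (1%:M : 'M[C]_n)^t* = 1%:M.
Proof. by rewrite trmx1 map_mx1. Qed.

Lemma hermE n (A : 'M[C]_n) : A \is hermsymmx -> A^t* = A.
Proof. by move/is_hermitianmxP => {2}->; rewrite expr0 scale1r. Qed.

(** The inner product of complex space viewed as a real space. The steps [t] are real and Hermitian
    forms take real values, so all estimates can be made in the ordered field [R]. *)
Definition dot n (x y : 'cV[C]_n) : R := complex.Re ((x^t* *m y) 0 0).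

Lemma dotC n (x y : 'cV[C]_n) : dot x y = dot y x.
Proof.
rewrite /dot -Re_conj; congr complex.Re.
have -> : y^t* *m x = (x^t* *m y)^t* by rewrite adjM trmxCK.
by rewrite !mxE.
Qed.

Lemma dotDr n (x y z : 'cV[C]_n) : dot x (y + z) = dot x y + dot x z.
Proof. by rewrite /dot mulmxDr mxE ReD. Qed.

Lemma dotNr n (x y : 'cV[C]_n) : dot x (- y) = - dot x y.
Proof. by rewrite /dot mulmxN mxE ReN. Qed.

Lemma dotZr n (t : R) (x y : 'cV[C]_n) : dot x (t%:C *: y) = t * dot x y.
Proof. by rewrite /dot -scalemxAr mxE ReZ. Qed.

Lemma dotDl n (x y z : 'cV[C]_n) : dot (x + y) z = dot x z + dot y z.
Proof. by rewrite dotC dotDr !(dotC z). Qed.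

Lemma dotNl n (x y : 'cV[C]_n) : dot (- x) y = - dot x y.
Proof. by rewrite dotC dotNr dotC. Qed.

Lemma dotZl n (t : R) (x y : 'cV[C]_n) : dot (t%:C *: x) y = t * dot x y.
Proof. by rewrite dotC dotZr dotC. Qed.

Lemma dot_addZ n (t : R) (x y p r : 'cV[C]_n) :
  dot (x + t%:C *: p) (y + t%:C *: r)
  = dot x y + t * dot x r + t * dot p y + t ^+ 2 * dot p r.
Proof.
by rewrite dotDl !dotDr !dotZl !dotZr; move: (dot _ _) (dot _ _) (dot _ _) (dot _ _) => *; ring.
Qed.

Lemma dot_subZ n (t : R) (x y p r : 'cV[C]_n) :
  dot (x - t%:C *: p) (y - t%:C *: r)
  = dot x y - t * dot x r - t * dot p y + t ^+ 2 * dot p r.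
Proof.
have subE (z w : 'cV[C]_n) : z - t%:C *: w = z + (- t)%:C *: w by rewrite rmorphN scaleNr.
by rewrite !subE dot_addZ; move: (dot _ _) (dot _ _) (dot _ _) (dot _ _) => *; ring.
Qed.

Lemma dot0r n (x : 'cV[C]_n) : dot x 0 = 0.
Proof. by rewrite /dot mulmx0 mxE. Qed.

Lemma dot_adj m n (A : 'M[C]_(m, n)) x y : dot x (A *m y) = dot (A^t* *m x) y.
Proof. by rewrite /dot adjM trmxCK mulmxA. Qed.

Lemma dot_herm n (A : 'M[C]_n) x y : A^t* = A -> dot x (A *m y) = dot (A *m x) y.
Proof. by move=> hA; rewrite dot_adj hA. Qed.

(** The squared modulus with values in [R], whereas the norm of [z] has values in [R[i]]. *)
Definition sqn (z : C) : R := complex.Re z ^+ 2 + complex.Im z ^+ 2.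

Lemma sqn_ge0 z : 0 <= sqn z.
Proof. by rewrite addr_ge0 ?sqr_ge0. Qed.

Lemma sqn0 : sqn 0 = 0.
Proof. by rewrite /sqn /= expr0n /= addr0. Qed.

Lemma sqnE z : sqn z = complex.Re (Num.conj z * z).
Proof. by rewrite conjE; case: z => a b /=; rewrite /sqn /=; ring. Qed.

Lemma sqn_norm z : sqn z = Normc.normc z ^+ 2.
Proof. by case: z => a b; rewrite sqr_sqrtr // addr_ge0 ?sqr_ge0. Qed.

Lemma sqn_eq0 z : sqn z = 0 -> z = 0.
Proof.
by move=> /eqP; rewrite sqn_norm sqrf_eq0 => /eqP/Normc.eq0_normc.
Qed.

Lemma sqnM z w : sqn (z * w) = sqn z * sqn w.
Proof. by rewrite !sqn_norm Normc.normcM exprMn. Qed.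

Lemma sqn_real (t : R) : sqn t%:C = t ^+ 2.
Proof. by rewrite /sqn /= [0 ^+ 2]mul0r addr0. Qed.

Lemma dotE n (x : 'cV[C]_n) : dot x x = \sum_k sqn (x k 0).
Proof.
rewrite /dot mxE Re_sum; apply: eq_bigr => k _.
by rewrite sqnE !mxE.
Qed.

Lemma dot_ge0 n (x : 'cV[C]_n) : 0 <= dot x x.
Proof. by rewrite dotE; apply: sumr_ge0 => k _; apply: sqn_ge0. Qed.

Lemma dot_eq0 n (x : 'cV[C]_n) : dot x x = 0 -> x = 0.
Proof.
rewrite dotE => /eqP; rewrite psumr_eq0; last by move=> *; exact: sqn_ge0.
move=> /allP h; apply/colP => k; rewrite mxE; apply: sqn_eq0; apply/eqP.
exact: h (mem_index_enum _).
Qed.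

Lemma dot_gt0 n (x : 'cV[C]_n) : x != 0 -> 0 < dot x x.
Proof.
by move=> x0; rewrite lt_def dot_ge0 andbT; apply: contra_neq x0 => /dot_eq0.
Qed.

Lemma enormE n (S : 'M[C]_n) x : enorm S x = Num.sqrt (dot x (S *m x)).
Proof. by rewrite /enorm /dot mulmxA. Qed.

Lemma norm2E n (x : 'cV[C]_n) : norm2 x = Num.sqrt (dot x x).
Proof. by rewrite /norm2 enormE mul1mx. Qed.

Lemma norm2_sqr n (x : 'cV[C]_n) : norm2 x ^+ 2 = dot x x.
Proof. by rewrite norm2E sqr_sqrtr // dot_ge0. Qed.

Lemma norm2_ge0 n (x : 'cV[C]_n) : 0 <= norm2 x.
Proof. by rewrite norm2E sqrtr_ge0. Qed.

Lemma sqn_sum_le (n : nat) (F : 'I_n -> C) :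
  sqn (\sum_k F k) <= (\sum_k Normc.normc (F k)) ^+ 2.
Proof.
rewrite sqn_norm; have ge0 z : 0 <= Normc.normc (z : C) by case: z => *; exact: sqrtr_ge0.
rewrite lerXn2r ?nnegrE ?sumr_ge0 //.
elim/big_ind2: _ => [|x1 x2 y1 y2 h1 h2|//]; first by rewrite Normc.normc0.
by apply: le_trans (lerD h1 h2); rewrite -lecR rmorphD; have := @ler_normD _ C x2 y2.
Qed.

(** Each entry of [A *m x] is at most the sum of the moduli in that row of [A] times the length of
    [x]. This crude bound makes the supremum in [specnorm] finite and later carries convergence from
    coordinates to vectors. *)
Lemma dot_mulmx_bounded m n (A : 'M[C]_(m, n)) : exists2 B, 0 <= B &
  forall x : 'cV[C]_n, dot (A *m x) (A *m x) <= B * dot x x.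
Proof.
have ge0 z : 0 <= Normc.normc (z : C) by case: z => *; exact: sqrtr_ge0.
exists (\sum_k (\sum_l Normc.normc (A k l)) ^+ 2) => [|x].
  by apply: sumr_ge0 => k _; exact: sqr_ge0.
rewrite [leLHS]dotE mulr_suml ler_sum // => k _; rewrite mxE (le_trans (sqn_sum_le _)) //.
have d0 := dot_ge0 x; have s0 := sqrtr_ge0 (dot x x).
rewrite -[X in _ * X](sqr_sqrtr d0) -exprMn.
have sum0 : 0 <= \sum_l Normc.normc (A k l) by apply: sumr_ge0.
rewrite lerXn2r ?nnegrE ?sumr_ge0 ?(mulr_ge0 sum0 s0) //.
rewrite mulr_suml ler_sum // => l _; rewrite Normc.normcM ler_wpM2l //.
rewrite -(@ler_pXn2r _ 2) ?nnegrE // sqr_sqrtr // -sqn_norm.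
by rewrite dotE (bigD1 l) //= lerDl sumr_ge0 // => *; exact: sqn_ge0.
Qed.

End AdjointMatrix.

(** * Decrease of the Rayleigh quotient in one step *)

Section SteepestDescentStep.
Local Open Scope sesquilinear_scope.
Variable R : realType.
Local Notation C := R[i].

Lemma kernel_vector (m n : nat) (A : 'M[C]_(m, n)) :
  (\rank A < n)%N -> exists2 x : 'cV[C]_n, x != 0 & A *m x = 0.
Proof.
move=> rA; have : kermx A^T != 0 by rewrite -mxrank_eq0 mxrank_ker mxrank_tr subn_eq0 -ltnNge.
case/rowV0Pn => v /sub_kermxP vA v0; exists v^T; first by rewrite trmx_eq0.
by apply: trmx_inj; rewrite trmx_mul trmxK vA trmx0.
Qed.

Lemma hpd_dot_gt0 n (S : 'M[C]_n) x : hpd S -> x != 0 -> 0 < dot x (S *m x).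
Proof.
by case=> _ h /h; rewrite /dot mulmxA ltcE /= => /andP[].
Qed.

Lemma hpd_dot_ge0 n (S : 'M[C]_n) x : hpd S -> 0 <= dot x (S *m x).
Proof.
move=> hS; have [->|x0] := eqVneq x 0; first by rewrite mulmx0 dot0r.
exact/ltW/hpd_dot_gt0.
Qed.

Lemma hpd_unit n (S : 'M[C]_n) : hpd S -> S \in unitmx.
Proof.
move=> hS; rewrite -row_full_unit /row_full eqn_leq rank_leq_col /= leqNgt.
apply/negP => /kernel_vector[x x0 Sx0].
by have := hpd_dot_gt0 hS x0; rewrite Sx0 dot0r ltxx.
Qed.

Lemma has_sup_specnorm n (A : 'M[C]_n) :
  has_sup [set norm2 (A *m x) | x in [set x : 'cV[C]_n | norm2 x <= 1]].
Proof.
split; first by exists (norm2 (A *m 0)), 0; rewrite //= norm2E dot0r sqrtr0.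
have [B B0 hB] := dot_mulmx_bounded A; exists (Num.sqrt B) => _ [x /= x1 <-].
rewrite norm2E ler_sqrt //; apply: le_trans (hB x) _.
by rewrite ler_piMr // -norm2_sqr expr_le1 // norm2_ge0.
Qed.

Lemma specnorm_ge0 n (A : 'M[C]_n) : 0 <= specnorm A.
Proof.
have [_ ub] := has_sup_specnorm A; apply: ub_le_sup => //.
by exists 0; rewrite /= ?mulmx0 norm2E dot0r sqrtr0.
Qed.

Lemma norm2Z n (t : R) (x : 'cV[C]_n) : 0 <= t -> norm2 (t%:C *: x) = t * norm2 x.
Proof.
by move=> t0; rewrite !norm2E dotZl dotZr mulrA -expr2 sqrtrM ?sqr_ge0 // sqrtr_sqr ger0_norm.
Qed.

Lemma norm2_mulmx_le n (A : 'M[C]_n) x : norm2 (A *m x) <= specnorm A * norm2 x.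
Proof.
have [->|x0] := eqVneq x 0.
  by rewrite mulmx0 norm2E dot0r sqrtr0 mulr0.
have nx : 0 < norm2 x by rewrite norm2E sqrtr_gt0 dot_gt0.
have [_ ub] := has_sup_specnorm A.
have : norm2 (A *m ((norm2 x)^-1%:C *: x)) <= specnorm A.
  apply: ub_le_sup => //; exists ((norm2 x)^-1%:C *: x) => //=.
  by rewrite norm2Z ?invr_ge0 ?norm2_ge0 // mulVf // gt_eqF.
rewrite -scalemxAr norm2Z ?invr_ge0 ?norm2_ge0 //.
by rewrite mulrC ler_pdivrMr.
Qed.

Lemma dot_mulmx_le n (A : 'M[C]_n) x :
  dot (A *m x) (A *m x) <= specnorm A ^+ 2 * dot x x.
Proof.
rewrite -!norm2_sqr -exprMn lerXn2r ?nnegrE ?norm2_ge0 ?norm2_mulmx_le //.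
by rewrite mulr_ge0 ?specnorm_ge0 ?norm2_ge0.
Qed.

Lemma hpd_cauchy_schwarz n (K : 'M[C]_n) x y : hpd K ->
  dot x (K *m y) ^+ 2 <= dot x (K *m x) * dot y (K *m y).
Proof.
move=> hK; have [->|y0] := eqVneq y 0.
  by rewrite mulmx0 !dot0r expr0n mulr0.
have yy := hpd_dot_gt0 hK y0; have hKE : K^t* = K by apply: hermE; case: hK.
have yx : dot y (K *m x) = dot x (K *m y) by rewrite dot_herm // dotC.
(* The form is evaluated at [a x - b y] with [a = y.K y] and [b = x.K y]. With [c = x.K x] its value
   is [a (c a - b^2)], and [a > 0]. *)
have := hpd_dot_ge0 ((dot y (K *m y))%:C *: x - (dot x (K *m y))%:C *: y) hK.
rewrite mulmxBr -!scalemxAr !(dotDl, dotDr, dotNl, dotNr, dotZl, dotZr) yx.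
move: (dot y _) (dot x _) (dot x _) yy => a b c a0 h.
have {h} : 0 <= a * (c * a - b ^+ 2) by move: h; congr (0 <= _); ring.
by rewrite pmulr_rge0 // subr_ge0.
Qed.

Lemma cauchy_schwarz n (x y : 'cV[C]_n) : dot x y ^+ 2 <= dot x x * dot y y.
Proof.
have h1 : hpd (1%:M : 'M[C]_n).
  split; first by apply/is_hermitianmxP; rewrite expr0 scale1r adj1.
  move=> z z0; have := dot_gt0 z0; rewrite dotE mulmx1 mxE => h.
  have -> : \sum_k (z ^t*) 0 k * z k 0 = (\sum_k sqn (z k 0))%:C.
    rewrite rmorph_sum; apply: eq_bigr => k _; rewrite !mxE conjE.
    by case: (z k 0) => a b; rewrite /sqn /=; simpc; congr Complex; ring.
  by rewrite ltcR.
by have := hpd_cauchy_schwarz x y h1; rewrite !mul1mx.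
Qed.

(* Cauchy-Schwarz in the [K]-inner product, applied to [x] and [K^-1 x]. *)
Lemma dot_le_specnorm_invmx n (K : 'M[C]_n) x : hpd K ->
  dot x x <= specnorm (invmx K) * dot x (K *m x).
Proof.
move=> hK; have [->|x0] := eqVneq x 0; first by rewrite mulmx0 !dot0r mulr0.
have xx := dot_gt0 x0; have uK := hpd_unit hK.
have := hpd_cauchy_schwarz x (invmx K *m x) hK.
rewrite mulKVmx // => h.
have nb := specnorm_ge0 (invmx K).
have h2 : dot (invmx K *m x) x <= specnorm (invmx K) * dot x x.
  have ge0 : 0 <= dot (invmx K *m x) x.
    by rewrite -[X in dot _ X](mulKVmx uK); exact: hpd_dot_ge0.
  have := le_trans (cauchy_schwarz _ _) (ler_wpM2r (ltW xx) (dot_mulmx_le (invmx K) x)).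
  move: (dot _ _) (dot _ _) (specnorm _) nb xx ge0 => c d s s0 c0 d0.
  rewrite -mulrA -[X in _ * X]expr2 -exprMn ler_pXn2r ?nnegrE //.
  by rewrite mulr_ge0 // ltW.
have xKx := hpd_dot_gt0 hK x0.
move: h h2 xx xKx.
move: (dot _ _) (dot _ _) (dot _ _) (specnorm _) nb => c b a s nb h h2 a0 b0.
have : a * a <= (s * b) * a.
  by rewrite -expr2 mulrAC mulrC (le_trans h) // ler_pM2l.
by rewrite ler_pM2r.
Qed.

(* [Ng], [gp], [Np], [xp] and [pLp] stand for [|g|^2], [g.p], [|p|^2], [x.p] and
   [p.(D - mu) p] with [p = K g]; the step used is [t = 1 / (L a^2 b)]. *)
Lemma step_size_bound (a b q L Ng gp Np xp pLp d : R) :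
  0 < L -> a * b <= q -> 0 <= a -> 0 <= b -> 0 < Ng -> 0 <= gp -> 0 <= d ->
  gp ^+ 2 <= Ng * Np ->
  Ng <= b * gp -> Np <= a ^+ 2 * Ng -> Ng <= L ^+ 2 -> pLp <= L * Np ->
  (forall t, 0 <= 1 + 2 * t * xp + t ^+ 2 * Np) ->
  (forall t, 2 * t * gp - t ^+ 2 * pLp <= d * (1 - 2 * t * xp + t ^+ 2 * Np)) ->
  Ng <= 4 * L * q ^+ 2 * d.
Proof.
move=> L0 abq a0 b0 Ng0 gp0 d0 CS hb ha NgL hp hpos hdec.
(* A condition number is at least 1: [Ng^2 <= (b gp)^2 <= b^2 Ng Np <= (a b Ng)^2]. Hence [a] and
   [b] are positive and [t] is a genuine inverse. *)
have ab1 : 1 <= a * b.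
  have : Ng ^+ 2 <= (a * b * Ng) ^+ 2.
    apply: (@le_trans _ _ ((b * gp) ^+ 2)).
      by rewrite ler_pXn2r ?nnegrE ?(mulr_ge0 b0 gp0) // ltW.
    have -> : (a * b * Ng) ^+ 2 = b ^+ 2 * (Ng * (a ^+ 2 * Ng)) by ring.
    rewrite exprMn ler_wpM2l ?sqr_ge0 //.
    by apply: le_trans CS _; rewrite ler_pM2l.
  have Ng_ge0 := ltW Ng0.
  by rewrite ler_pXn2r ?nnegrE // ?(mulr_ge0 (mulr_ge0 a0 b0)) // ler_pMl.
have {a0} a0 : 0 < a by rewrite lt_def a0 andbT; apply: contraTneq ab1 => ->; rewrite mul0r ler10.
have {b0} b0 : 0 < b by rewrite lt_def b0 andbT; apply: contraTneq ab1 => ->; rewrite mulr0 ler10.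
pose t := (L * a ^+ 2 * b)^-1.
have s0 : 0 < L * a ^+ 2 * b by rewrite !mulr_gt0 ?exprn_gt0.
have t0 : 0 < t by rewrite invr_gt0.
have st : L * a ^+ 2 * b * t = 1 by rewrite divff // gt_eqF.
have tt : 0 <= t ^+ 2 by rewrite sqr_ge0.
have ab0 : 0 < (a * b) ^+ 2 by rewrite exprn_gt0 ?mulr_gt0.
have ab2 : 1 <= (a * b) ^+ 2 by rewrite expr_ge1 // ltW // mulr_gt0.
(* [t^2 Np <= (t a L)^2 = 1 / (a b)^2 <= 1]. *)
have tNp : t ^+ 2 * Np <= 1.
  apply: (@le_trans _ _ (t ^+ 2 * (a ^+ 2 * L ^+ 2))).
    by rewrite ler_wpM2l // (le_trans ha) // ler_wpM2l // sqr_ge0.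
  rewrite -(ler_pM2r ab0) mul1r; apply: le_trans ab2.
  rewrite le_eqVlt; apply/orP; left; apply/eqP.
  by transitivity ((L * a ^+ 2 * b * t) ^+ 2); [ring | rewrite st expr1n].
(* [hpos] gives [- 2 t xp <= 1 + t^2 Np], so the squared length of [x - t p] is at most
   [2 + 2 t^2 Np]. *)
have low : 1 - 2 * t * xp + t ^+ 2 * Np <= 4 by have := hpos t; lra.
have up := le_trans (hdec t) (ler_wpM2l d0 low).
have pL : t ^+ 2 * pLp <= t ^+ 2 * (L * (a ^+ 2 * Ng)).
  by rewrite ler_wpM2l // (le_trans hp) // ler_wpM2l // ltW.
(* By the choice of [t], the second-order term times [b] is at most [t Ng], while the first-order
   term times [b] is at least [2 t Ng]. What remains is [t Ng <= 4 b d]. *)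
have E1 : b * (t ^+ 2 * (L * (a ^+ 2 * Ng))) = t * Ng.
  by rewrite -[t * Ng]mul1r -st; ring.
have E2 : t * Ng <= t * (b * gp) by rewrite ler_wpM2l // ltW.
have B1 : t * Ng <= b * (d * 4).
  apply: le_trans (ler_wpM2l (ltW b0) up).
  have := ler_wpM2l (ltW b0) pL; rewrite E1; move: E2; clear; lra.
have B2 : Ng <= L * a ^+ 2 * b * (b * (d * 4)).
  by have := ler_wpM2l (ltW s0) B1; rewrite (mulrA _ t) st mul1r.
apply: le_trans B2 _.
have -> : L * a ^+ 2 * b * (b * (d * 4)) = 4 * L * d * (a * b) ^+ 2 by ring.
have -> : 4 * L * q ^+ 2 * d = 4 * L * d * q ^+ 2 by ring.
have ab_gt0 : 0 < a * b by rewrite mulr_gt0.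
have L_ge0 := ltW L0; have q_ge0 := le_trans (ltW ab_gt0) abq.
by apply: ler_wpM2l; rewrite ?mulr_ge0 // ler_pXn2r ?nnegrE // ltW.
Qed.

(** Subtracting [mu] times the squared length of the test vector from the last hypothesis gives the
    quadratic inequality in [t] of [step_size_bound], with [d = mu - th]. *)
Lemma step_decrease n (D K : 'M[C]_n) (x : 'cV[C]_n) (mu th L q : R) :
  let g := D *m x - mu%:C *: x in
  D^t* = D -> hpd K -> 0 < L -> cond2 K <= q ->
  dot x x = 1 -> dot x (D *m x) = mu ->
  dot g g <= L ^+ 2 ->
  (forall y, dot y (D *m y) - mu * dot y y <= L * dot y y) ->
  (forall t : R, th * dot (x - t%:C *: (K *m g)) (x - t%:C *: (K *m g))
     <= dot (x - t%:C *: (K *m g)) (D *m (x - t%:C *: (K *m g)))) ->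
  dot g g <= 4 * L * q ^+ 2 * (mu - th).
Proof.
move=> g hD hK L0 hq xx xDx gL yL hth.
have thmu : th <= mu.
  by have := hth 0; rewrite (_ : 0%:C = 0 :> C) // scale0r subr0 xx xDx mulr1.
have [->|g0] := eqVneq g 0.
  by rewrite dot0r mulr_ge0 ?subr_ge0 // (mulr_ge0 _ (sqr_ge0 q)) // (mulr_ge0 _ (ltW L0)).
have gg := dot_gt0 g0.
pose a := specnorm K; pose b := specnorm (invmx K).
have a_ge0 : 0 <= a by apply: specnorm_ge0.
have b_ge0 : 0 <= b by apply: specnorm_ge0.
have hq' : a * b <= q by [].
have hb : dot g g <= b * dot g (K *m g) by apply: dot_le_specnorm_invmx.
have ha : dot (K *m g) (K *m g) <= a ^+ 2 * dot g g by apply: dot_mulmx_le.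
set p := K *m g in hth hb ha *.
have gp : 0 < dot g p by apply: hpd_dot_gt0.
have CS := cauchy_schwarz g p.
(* Substituting [D x = g + mu x] turns the first-order term of the quotient into [g.p]. *)
have xg : dot p (D *m x) = dot g p + mu * dot x p.
  by rewrite dotC /g dotDl dotNl dotZl subrK.
have hxD : dot x (D *m p) = dot p (D *m x) by rewrite (dot_herm x p hD) dotC.
apply: (step_size_bound L0 hq' a_ge0 b_ge0 gg (ltW gp) _ CS hb ha gL (yL p) (xp := dot x p)) => [|t|t].
- by rewrite subr_ge0.
- have := dot_ge0 (x + t%:C *: p).
  rewrite dot_addZ xx (dotC p x); move: (dot x p) (dot p p) => e f; congr (0 <= _); ring.
- have := hth t; rewrite mulmxBr -scalemxAr !dot_subZ xx xDx (dotC p x) hxD xg.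
  move: (dot g p) (dot x p) (dot p _) (dot p p) => e f k l.
  move=> h; rewrite -subr_ge0; move: h; rewrite -subr_ge0; congr (0 <= _); ring.
Qed.

End SteepestDescentStep.

(** * Convergence in eigenvector coordinates *)

Section Convergence.
Local Open Scope sesquilinear_scope.
Variable R : realType.
Local Notation C := R[i].

Lemma cvg_dot_sub0 n (z : nat -> 'cV[C]_n) (v : 'cV[C]_n) :
  (fun j => dot (z j - v) (z j - v)) @ \oo --> (0 : R) ->
  (z : nat -> 'cV[C^o]_n) @ \oo --> (v : 'cV[C^o]_n).
Proof.
move=> h; apply/cvg_ballP => -[e e'] e0.
(* Balls over [R[i]] have a complex radius, and its positivity forces a zero imaginary part. *)
have [e'0 {}e0] : e' = 0 /\ 0 < e.
  by move: e0; rewrite ltcE /= => /andP[/eqP].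
rewrite e'0.
move/cvgrPdist_lt : h => /(_ (e ^+ 2) (exprn_gt0 _ e0)).
apply: filterS => j; rewrite sub0r normrN ger0_norm ?dot_ge0 // => hj.
split; first by rewrite ltcR.
move=> k l; rewrite (ord1 l) {l}.
have hk : Normc.normc (z j k 0 - v k 0) < e.
  rewrite -(@ltr_pXn2r _ 2) ?nnegrE //; last 2 first.
  - by case: (_ - _) => *; exact: sqrtr_ge0.
  - exact: ltW.
  rewrite -sqn_norm; apply: le_lt_trans hj.
  rewrite dotE (bigD1 k) //= !mxE lerDl sumr_ge0 // => *; exact: sqn_ge0.
change (`|(v k 0 : C) - z j k 0| < e%:C).
by rewrite distrC; change ((Normc.normc (z j k 0 - v k 0))%:C < e%:C); rewrite ltcR.
Qed.

Definition diagC n (d : 'I_n -> R) : 'M[C]_n := diag_mx (\row_k (d k)%:C).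

Lemma diagC_adj n (d : 'I_n -> R) : (diagC d)^t* = diagC d.
Proof.
rewrite tr_diag_mx map_diag_mx; congr diag_mx; apply/rowP => k.
by rewrite !mxE; exact: conj_real_complex.
Qed.

Lemma diagC_mulE n (d : 'I_n -> R) (x : 'cV[C]_n) k :
  (diagC d *m x) k 0 = (d k)%:C * x k 0.
Proof. by rewrite mul_diag_mx !mxE. Qed.

Lemma dot_diagC n (d : 'I_n -> R) (x : 'cV[C]_n) :
  dot x (diagC d *m x) = \sum_k d k * sqn (x k 0).
Proof.
rewrite /dot mxE Re_sum; apply: eq_bigr => k _.
by rewrite diagC_mulE !mxE mulrCA ReZ -sqnE.
Qed.

Lemma dot_shifted_diagC n (d : 'I_n -> R) (mu : R) (x : 'cV[C]_n) :
  dot (diagC d *m x - mu%:C *: x) (diagC d *m x - mu%:C *: x)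
  = \sum_k (d k - mu) ^+ 2 * sqn (x k 0).
Proof.
rewrite dotE; apply: eq_bigr => k _.
by rewrite mxE diagC_mulE !mxE -mulrBl -rmorphB sqnM sqn_real.
Qed.

(** The phase turns the coordinate at [k0] into its modulus [r] (the phase is 1 if that coordinate
    vanishes). The squared distance is then [2 - 2 r], and [r^2 <= r] as [0 <= r <= 1]. *)
Lemma unit_vector_phase n (x : 'cV[C]_n) (k0 : 'I_n) : dot x x = 1 ->
  exists2 c : C, `|c| = 1 &
    dot (c *: x - delta_mx k0 0) (c *: x - delta_mx k0 0) <= 2 * (1 - sqn (x k0 0)).
Proof.
move=> xx; set z := x k0 0; set r := Normc.normc z.
have r0 : 0 <= r by rewrite /r; case: (z) => *; exact: sqrtr_ge0.
have [c c1 cz] : exists2 c : C, `|c| = 1 & c * z = r%:C.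
  have [z0|z0] := eqVneq z 0.
    by exists 1; rewrite ?normr1 // /r z0 Normc.normc0 mulr0.
  have nz : `|z| != 0 by rewrite normr_eq0.
  exists (Num.conj z / `|z|).
    by rewrite normrM normfV norm_conjC normr_id divff.
  by rewrite mulrAC (mulrC (Num.conj z)) -normCK expr2 mulfK.
exists c => //.
have c1' : sqn c = 1.
  by rewrite sqn_norm; have /eqP := c1; rewrite eq_complex /= => /andP[/eqP-> _]; rewrite expr1n.
have de (y : 'cV[C]_n) : dot (delta_mx k0 0) y = complex.Re (y k0 0).
  rewrite /dot trmx_delta map_delta_mx -rowE mxE //.
have cx : dot (c *: x) (c *: x) = 1.
  by rewrite -xx !dotE; apply: eq_bigr => k _; rewrite mxE sqnM c1' mul1r.
rewrite dotDl !dotDr !dotNl !dotNr (dotC (c *: x)) !de cx !mxE !eqxx cz /=.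
have r1 : r ^+ 2 <= 1.
  rewrite -sqn_norm -xx dotE (bigD1 k0) //= lerDl sumr_ge0 // => *; exact: sqn_ge0.
rewrite sqn_norm -/r; nra.
Qed.

(** A decreasing sequence bounded below has decrements tending to 0, hence so does [g]. The gap
    between [mu 0] and [b] then concentrates the unit vectors on the coordinate [k0]. *)
Lemma convergence_of_decrease n (d : 'I_n -> R) (k0 : 'I_n)
    (x : nat -> 'cV[C]_n) (mu : nat -> R) (c b : R) :
  let g j := diagC d *m x j - (mu j)%:C *: x j in
  (forall j, dot (x j) (x j) = 1) ->
  (forall j, dot (x j) (diagC d *m x j) = mu j) ->
  (forall j, mu j.+1 <= mu j) ->
  (forall j, dot (g j) (g j) <= c * (mu j - mu j.+1)) ->
  (forall k, d k0 <= d k) ->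
  (forall k, k != k0 -> b <= d k) -> mu 0%N < b ->
  [/\ mu @ \oo --> d k0, (fun j => dot (g j) (g j)) @ \oo --> (0 : R)
    & exists2 p : nat -> C, forall j, `|p j| = 1 &
      (fun j => dot (p j *: x j - delta_mx k0 0) (p j *: x j - delta_mx k0 0))
        @ \oo --> (0 : R)].
Proof.
move=> g xx xDx mudec gdec dmin db mub.
have sum1 j : \sum_k sqn (x j k 0) = 1 by rewrite -dotE.
have mu_ge j : d k0 <= mu j.
  rewrite -xDx dot_diagC -[leLHS]mulr1 -(sum1 j) mulr_sumr ler_sum // => k _.
  by rewrite ler_wpM2r // sqn_ge0.
have mu_noninc : {homo mu : a b / (a <= b)%N >-> b <= a}.
  by apply/nonincreasing_seqP.
have mu_cvg : cvgn mu.
  by apply: nonincreasing_is_cvgn => //; exists (d k0) => _ [j _ <-].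
have g_cvg : (fun j => dot (g j) (g j)) @ \oo --> (0 : R).
  have cv0 : (fun j => c * (mu j - mu j.+1)) @ \oo --> (0 : R).
    rewrite -[0](mulr0 c) -(subrr (limn mu)); apply: cvgMr; apply: cvgB => //.
    by rewrite (cvg_shiftS mu).
  apply: (squeeze_cvgr _ (cvg_cst 0) cv0).
  by near=> j; rewrite dot_ge0 gdec.
(* For [k != k0], [d k - mu j >= b - mu 0 > 0], so [e] times the squared length of [g j] bounds the
   mass of [x j] outside [k0]. *)
pose e := ((b - mu 0%N) ^+ 2)^-1.
have bmu : 0 < (b - mu 0%N) ^+ 2 by rewrite exprn_gt0 // subr_gt0.
have e0 : 0 < e by rewrite invr_gt0.
have tail j : \sum_(k | k != k0) sqn (x j k 0) <= e * dot (g j) (g j).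
  rewrite mulrC -[leRHS]/(_ / _) ler_pdivlMr // dot_shifted_diagC.
  rewrite [leRHS](bigD1 k0) //= ler_wpDl //.
    by rewrite mulr_ge0 ?sqr_ge0 ?sqn_ge0.
  rewrite mulr_suml ler_sum // => k kk0; rewrite mulrC ler_wpM2r ?sqn_ge0 //.
  have h0 := mu_noninc _ _ (leq0n j); have hb := db _ kk0.
  by rewrite lerXn2r ?nnegrE; lra.
have head j : 1 - sqn (x j k0 0) <= e * dot (g j) (g j).
  by apply: le_trans (tail j); have := sum1 j; rewrite lerBlDl (bigD1 k0) //= => ->.
have term j k : k != k0 -> sqn (x j k 0) <= e * dot (g j) (g j).
  move=> kk0; apply: le_trans (tail j).
  by rewrite (bigD1 k) //= lerDl sumr_ge0 // => *; exact: sqn_ge0.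
split => //.
  apply/subr_cvg0.
  (* [mu j - d k0] is the sum of the [(d k - d k0) * sqn (x j k 0)]. The term at [k0] vanishes and
     [term] bounds the others. *)
  pose B := (\sum_k (d k - d k0)) * e.
  have cvB : (fun j => B * dot (g j) (g j)) @ \oo --> (0 : R).
    by rewrite -[0](mulr0 B); apply: cvgMr.
  apply: (squeeze_cvgr _ (cvg_cst 0) cvB).
  near=> j; rewrite /= subr_ge0 mu_ge /= -xDx dot_diagC -[d k0]mulr1 -{1}(sum1 j).
  rewrite mulr_sumr -sumrB /B -mulrA mulr_suml ler_sum // => k _; rewrite -mulrBl.
  have [->|kk0] := eqVneq k k0; first by rewrite subrr !mul0r.
  by rewrite ler_wpM2l ?subr_ge0 // term.
pose P j p := `|p| = 1 /\ dot (p *: x j - delta_mx k0 0) (p *: x j - delta_mx k0 0)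
   <= 2 * (1 - sqn (x j k0 0)).
have /choice[p hp] : forall j, exists p : C, P j p.
  by move=> j; have [p p1 h] := unit_vector_phase k0 (xx j); exists p.
exists p => [j|]; first by case: (hp j).
have cvB : (fun j => 2 * (e * dot (g j) (g j))) @ \oo --> (0 : R).
  rewrite -[0](mulr0 2) -(mulr0 e); apply: cvgMr; apply: cvgMr; exact: g_cvg.
apply: (squeeze_cvgr _ (cvg_cst 0) cvB).
near=> j; rewrite dot_ge0 /=; have [_ h] := hp j; apply: le_trans h _.
by rewrite ler_wpM2l.
Unshelve. all: by end_near. Qed.

End Convergence.

(** * Rayleigh-Ritz with deflation *)

Section RayleighRitz.
Local Open Scope sesquilinear_scope.
Variable R : realType.
Local Notation C := R[i].

Lemma dot_adjl m n (A : 'M[C]_(m, n)) x y : dot (A *m x) y = dot x (A^t* *m y).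
Proof. by rewrite dot_adj trmxCK. Qed.

Lemma herm_congr m n (H : 'M[C]_n) (Z : 'M[C]_(n, m)) :
  H^t* = H -> (Z^t* *m H *m Z)^t* = Z^t* *m H *m Z.
Proof. by move=> hH; rewrite !adjM trmxCK hH mulmxA. Qed.

(** * Both quadratic forms in the coordinates of an eigenbasis *)

Section Eigensystem.
Variables (n : nat) (H S : 'M[C]_n) (lam : 'I_n -> R) (U : 'M[C]_n).
Hypothesis hU : eigensystem H S lam U.

Lemma eigensystem_mul : H *m U = S *m U *m diagC lam.
Proof.
have [hk _ _] := hU; apply/matrixP => a k.
have := congr1 (fun v : 'cV[C]_n => v a 0) (hk k).
rewrite /diagC mul_mx_diag !colE !mulmxA -!colE.
by rewrite [X in X = _ -> _]mxE => ->; rewrite ![in LHS]mxE ![in RHS]mxE mulrC.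
Qed.

Lemma eigensystem_gram : U^t* *m S *m U = 1%:M.
Proof. by case: hU. Qed.

(** A left inverse of a square matrix is also a right inverse. So [U^t* *m S *m v] is the coordinate
    vector of [v] in the eigenbasis. *)
Lemma eigensystem_resolution : U *m (U^t* *m S) = 1%:M.
Proof. exact: mulmx1C eigensystem_gram. Qed.

Lemma eigensystem_expand (v : 'cV[C]_n) : v = U *m (U^t* *m S *m v).
Proof. by rewrite mulmxA eigensystem_resolution mul1mx. Qed.

Lemma eigensystem_dotS (v : 'cV[C]_n) :
  dot v (S *m v) = \sum_k sqn ((U^t* *m S *m v) k 0).
Proof.
rewrite -dotE; set c := _ *m S *m v; rewrite [X in dot X _](eigensystem_expand v) -/c.
by rewrite dot_adjl mulmxA.
Qed.

Lemma eigensystem_dotH (v : 'cV[C]_n) :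
  dot v (H *m v) = \sum_k lam k * sqn ((U^t* *m S *m v) k 0).
Proof.
rewrite -dot_diagC; set c := _ *m S *m v; rewrite [v in LHS](eigensystem_expand v) -/c.
by rewrite dot_adjl (mulmxA H) eigensystem_mul !mulmxA eigensystem_gram mul1mx.
Qed.

(** Both forms are weighted sums of the same squared moduli, and the surviving weights of the
    [H]-form are at least [lam k0]. *)
Lemma rayleigh_ge (k0 : 'I_n) (v : 'cV[C]_n) :
  (forall k : 'I_n, (k < k0)%N -> (U^t* *m S *m v) k 0 = 0) ->
  lam k0 * dot v (S *m v) <= dot v (H *m v).
Proof.
have [_ _ mono] := hU => h.
rewrite eigensystem_dotH eigensystem_dotS mulr_sumr ler_sum // => k _.
have [kk0|k0k] := ltnP k k0; first by rewrite h // sqn0 !mulr0.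
by rewrite ler_wpM2r ?sqn_ge0 ?mono.
Qed.

Lemma rayleigh_le (k0 : 'I_n) (v : 'cV[C]_n) :
  (forall k : 'I_n, (k0 < k)%N -> (U^t* *m S *m v) k 0 = 0) ->
  dot v (H *m v) <= lam k0 * dot v (S *m v).
Proof.
have [_ _ mono] := hU => h.
rewrite eigensystem_dotH eigensystem_dotS mulr_sumr ler_sum // => k _.
have [kk0|k0k] := ltnP k0 k; first by rewrite h // sqn0 !mulr0.
by rewrite ler_wpM2r ?sqn_ge0 ?mono.
Qed.

Lemma Uprev_adjM (i : 'I_n) m (B : 'M[C]_(n, m)) :
  (Uprev i U)^t* *m B = rowsub (widen_ord (ltnW (ltn_ord i))) (U^t* *m B).
Proof. by rewrite /Uprev trmx_mxsub map_mxsub mul_rowsub_mx. Qed.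

Lemma Uprev_coord0 (i : 'I_n) (v : 'cV[C]_n) :
  (Uprev i U)^t* *m S *m v = 0 ->
  forall k : 'I_n, (k < i)%N -> (U^t* *m S *m v) k 0 = 0.
Proof.
rewrite Uprev_adjM mul_rowsub_mx => /colP h k ki.
have := h (Ordinal ki); rewrite mxE [RHS]mxE => <-.
by congr (_ _ 0); apply: val_inj.
Qed.

Lemma Uprev_mul (i : 'I_n) :
  H *m Uprev i U
  = S *m Uprev i U *m diagC (fun k => lam (widen_ord (ltnW (ltn_ord i)) k)).
Proof.
rewrite /Uprev !mulmx_colsub eigensystem_mul /diagC !mul_mx_diag.
by apply/matrixP => a k; rewrite !mxE.
Qed.

Lemma Uprev_gram (i : 'I_n) : (Uprev i U)^t* *m S *m Uprev i U = 1%:M.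
Proof.
rewrite Uprev_adjM mul_rowsub_mx /Uprev mulmx_colsub eigensystem_gram.
by apply/matrixP => a k; rewrite !mxE.
Qed.

End Eigensystem.

Lemma mulmx_inj_rank m n (Z : 'M[C]_(m, n)) (y : 'cV[C]_n) :
  \rank Z = n -> Z *m y = 0 -> y = 0.
Proof.
move=> rZ Zy; apply/eqP; rewrite -trmx_eq0.
have fZ : row_free Z^T by rewrite /row_free mxrank_tr rZ.
by rewrite -(mulmx_free_eq0 _ fZ) -trmx_mul Zy trmx0.
Qed.

(** * Ritz pairs of a trial space that contains the deflated eigenvectors *)

Section DeflatedRitz.
Variables (n p : nat) (H S : 'M[C]_n) (lam : 'I_n -> R) (U : 'M[C]_n) (i : 'I_n).
(* [G] and [M] are kept as variables: as local definitions they would be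
   unfolded by the associativity rewritings. *)
Variables (Y : 'M[C]_(n, p.+1)) (Z : 'M[C]_(n, i + p.+1)) (G M : 'M[C]_(i + p.+1)).
Hypotheses (ZE : Z = row_mx (Uprev i U) Y) (rZ : \rank Z = (i + p.+1)%N).
Hypotheses (GE : G = Z^t* *m H *m Z) (ME : M = Z^t* *m S *m Z).
Hypotheses (hH : H^t* = H) (hS : hpd S) (hU : eigensystem H S lam U).
Hypothesis hlam : forall k : 'I_n, (k < i)%N -> lam k < lam i.
Variables (th : 'I_(i + p.+1) -> R) (W : 'M[C]_(i + p.+1)).
Hypothesis hW : eigensystem G M th W.
(** Only the value 0 of [l0] matters: the iteration writes this position as [lshift 1 ord0], which
    is not syntactically [ord0]. *)
Variable l0 : 'I_p.+1.
Hypothesis l0E : (l0 : nat) = 0%N.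
Let i0 := rshift i l0.

Let hSE : S^t* = S. Proof. by apply: hermE; case: hS. Qed.
Let hG : G^t* = G. Proof. by rewrite GE herm_congr. Qed.
Let hM : M^t* = M. Proof. by rewrite ME herm_congr. Qed.

Let dotG y : dot y (G *m y) = dot (Z *m y) (H *m (Z *m y)).
Proof. by rewrite dot_adjl GE !mulmxA. Qed.

Let dotM y : dot y (M *m y) = dot (Z *m y) (S *m (Z *m y)).
Proof. by rewrite dot_adjl ME !mulmxA. Qed.

(* Courant-Fischer: [i + p + 1] unknowns against the [i] conditions of deflation
   and the vanishing of the [p] Ritz components above the position [i0]. *)
Lemma ritz_ge : lam i <= th i0.
Proof.
pose A := col_mx ((Uprev i U)^t* *m S *m Z) (row' l0 (dsubmx (W^t* *m M))).
have [|y y0 Ay] := @kernel_vector _ _ _ A.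
  by apply: leq_ltn_trans (rank_leq_row _) _; rewrite /= addnS.
move/eqP: Ay; rewrite mul_col_mx col_mx_eq0 => /andP[/eqP Ay1 /eqP Ay2].
have Zy0 : Z *m y != 0 by apply: contra_neq y0; exact: mulmx_inj_rank.
have N0 := hpd_dot_gt0 hS Zy0.
rewrite -(ler_pM2r N0); apply: (@le_trans _ _ (dot (Z *m y) (H *m (Z *m y)))).
  by apply: (rayleigh_ge hU); apply: Uprev_coord0; rewrite mulmxA.
rewrite -dotG -dotM; apply: (rayleigh_le hW) => k.
case: (split_ordP k) => l ->; first by rewrite /= l0E addn0 ltnNge ltnW ?ltn_ord.
rewrite /= ltn_add2l => l0l.
have [l' El|El] := unliftP l0 l; last by rewrite El ltnn in l0l.
move/colP: Ay2 => /(_ l'); rewrite [RHS]mxE => <-.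
by rewrite El !mxE; apply: eq_bigr => j _; rewrite !mxE.
Qed.

(** The coordinates of the deflated eigenvectors in the trial basis. *)
Let E : 'M[C]_(i + p.+1, i) := col_mx 1%:M 0.
Let ZEE : Z *m E = Uprev i U.
Proof. by rewrite ZE mul_row_col mulmx1 mulmx0 addr0. Qed.

Let EM : E^t* *m M = (Uprev i U)^t* *m S *m Z.
Proof. by rewrite ME -ZEE adjM !mulmxA. Qed.

Let EMy (y : 'cV[C]_(i + p.+1)) :
  E^t* *m M *m y = (Uprev i U)^t* *m S *m (Z *m y).
Proof. by rewrite EM mulmxA. Qed.

(** The deflated eigenpairs remain eigenpairs of the projected pair [(G, M)]. *)
Let GEE (d := fun k : 'I_i => lam (widen_ord (ltnW (ltn_ord i)) k)) :
  G *m E = M *m E *m diagC d.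
Proof.
rewrite GE ME -(mulmxA _ Z E) -(mulmxA _ Z E) ZEE -(mulmxA _ H) (Uprev_mul hU).
by rewrite !mulmxA.
Qed.

(** Eigenvectors for distinct eigenvalues are [M]-orthogonal: by [ritz_ge] the Ritz values from
    position [i0] on are at least [lam i], which exceeds the deflated eigenvalues. *)
Lemma ritz_deflated (l : 'I_p.+1) (k : 'I_i) : (W^t* *m M *m E) (rshift i l) k = 0.
Proof.
have [_ _ mono] := hW; have := GEE.
set Q := _ *m M *m E; set d := fun k : 'I_i => _ => GEd.
have WG : W^t* *m G = diagC th *m (W^t* *m M).
  by rewrite -hG -adjM (eigensystem_mul hW) (adjM (M *m W)) (adjM M) hM diagC_adj.
have : (diagC th *m Q) (rshift i l) k = (Q *m diagC d) (rshift i l) k.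
  by rewrite /Q (mulmxA (diagC th)) -WG -(mulmxA _ G) GEd !mulmxA.
rewrite mul_diag_mx mul_mx_diag !mxE mulrC => /eqP.
rewrite -subr_eq0 -mulrBr mulf_eq0 => /orP[/eqP //|].
rewrite -rmorphB eq_complex /= eqxx andbT subr_eq0 => /eqP thl.
have : lam i <= th (rshift i l).
  by apply: le_trans ritz_ge (mono _ _ _); rewrite /= l0E addn0 leq_addr.
by rewrite thl leNgt hlam //= ltn_ord.
Qed.

(** The adjoint form of [ritz_deflated]; through it the iteration preserves the deflation
    condition. *)
Lemma ritz_vector_deflated (l : 'I_p.+1) :
  (Uprev i U)^t* *m S *m (Z *m col (rshift i l) W) = 0.
Proof.
rewrite -EMy colE mulmxA -colE; apply/colP => k; rewrite mxE [RHS]mxE.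
have -> : E^t* *m M *m W = (W^t* *m M *m E)^t*.
  by rewrite (adjM (_ *m M)) (adjM _ M) trmxCK hM mulmxA.
have h := ritz_deflated l k; move: (_ *m M *m E) h => Q h.
by rewrite mxE mxE h conjC0.
Qed.

Lemma ritz_vector_dotS l : dot (Z *m col l W) (S *m (Z *m col l W)) = 1.
Proof.
rewrite -dotM (eigensystem_dotS hW) colE mulmxA (eigensystem_gram hW) mul1mx.
rewrite (bigD1 l) //= !mxE !eqxx big1 => [|k kl].
  by rewrite addr0 sqn_real expr1n.
by rewrite !mxE (negPf kl) sqn0.
Qed.

Lemma ritz_vector_dotH l : dot (Z *m col l W) (H *m (Z *m col l W)) = th l.
Proof.
have [hk _ _] := hW.
by rewrite -dotG hk dotZr dotM ritz_vector_dotS mulr1.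
Qed.

(* The Ritz vectors from position [i] on are [M]-orthogonal to [E], so the block
   [usubmx Q] of [Q = W^* M E] is unitary: the first [i] Ritz vectors span the
   same space as [E], and a deflated [y] has no component along them. *)
Lemma ritz_optimal (y : 'cV[C]_(i + p.+1)) :
  (Uprev i U)^t* *m S *m (Z *m y) = 0 ->
  th i0 * dot (Z *m y) (S *m (Z *m y)) <= dot (Z *m y) (H *m (Z *m y)).
Proof.
rewrite -EMy => Ey; rewrite -dotG -dotM; apply: (rayleigh_ge hW) => k.
(* The existential keeps [Q] opaque to the rewritings with associativity. *)
have [Q QD] : exists Q, Q = W^t* *m M *m E by exists (W^t* *m M *m E).
have dQ : dsubmx Q = 0.
  by apply/matrixP => l j; have := ritz_deflated l j; rewrite -QD => h; rewrite mxE [RHS]mxE.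
have QE : Q = col_mx (usubmx Q) 0 by rewrite -dQ vsubmxK.
have EWQ : E = W *m Q by rewrite QD mulmxA (eigensystem_resolution hW) mul1mx.
have Qy m (z : 'M[C]_(i + p.+1, m)) : Q^t* *m (W^t* *m M *m z) = E^t* *m M *m z.
  by rewrite [in RHS]EWQ (adjM W) !mulmxA.
have QQ : (usubmx Q)^t* *m usubmx Q = 1%:M.
  transitivity (Q^t* *m Q).
    by rewrite [in RHS]QE tr_col_mx map_row_mx mul_row_col trmx0 map_mx0 mul0mx addr0.
  by rewrite [X in _ *m X]QD Qy EM -mulmxA ZEE (Uprev_gram hU).
have : usubmx (W^t* *m M *m y) = 0.
  (* [usubmx Q] is square, so [QQ] also holds with the factors exchanged. *)
  rewrite -[LHS]mul1mx -(mulmx1C QQ) -(mulmxA (usubmx Q)).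
  suff -> : (usubmx Q)^t* *m usubmx (W^t* *m M *m y) = 0 by rewrite mulmx0.
  rewrite -[RHS]Ey -Qy [in RHS]QE -[X in _ = _ *m X]vsubmxK.
  by rewrite tr_col_mx map_row_mx mul_row_col trmx0 map_mx0 mul0mx addr0.
case: (split_ordP k) => l -> /colP h.
  by move=> _; have := h l; rewrite mxE [RHS]mxE.
by rewrite /= l0E addn0 ltnNge leq_addr.
Qed.

End DeflatedRitz.
End RayleighRitz.

(** * The iteration in the deflated coordinates *)

Section Complement.
Local Open Scope sesquilinear_scope.
Variables (R : realType) (n : nat).
Local Notation C := R[i].
Variables (H S : 'M[C]_n) (lam : 'I_n -> R) (U : 'M[C]_n) (i : 'I_n).
Hypotheses (hS : hpd S) (hU : eigensystem H S lam U).

Let emb (k : 'I_(n - i)) : 'I_n := cast_ord (subnKC (ltnW (ltn_ord i))) (rshift i k).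
Let Up := Uprev i U.
Let Uc := Ucompl i U.

Lemma Ucompl_gram : Uc^t* *m S *m Uc = 1%:M.
Proof.
rewrite /Uc /Ucompl trmx_mxsub map_mxsub !mul_rowsub_mx mulmx_colsub.
rewrite (eigensystem_gram hU); apply/matrixP => a k; rewrite !mxE -!val_eqE /=.
by rewrite eqn_add2l.
Qed.

Lemma Uprev_Ucompl_gram : Up^t* *m S *m Uc = 0.
Proof.
rewrite (Uprev_adjM U i S) mul_rowsub_mx /Uc /Ucompl mulmx_colsub (eigensystem_gram hU).
apply/matrixP => a k; rewrite !mxE -val_eqE /= ltn_eqF //.
by apply: leq_trans (leq_addr _ _).
Qed.

Lemma Ucompl_mul : H *m Uc = S *m Uc *m diagC (fun k => lam (emb k)).
Proof.
rewrite /Uc /Ucompl !mulmx_colsub (eigensystem_mul hU) /diagC !mul_mx_diag.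
by apply/matrixP => a k; rewrite !mxE.
Qed.

(** The resolution of the identity over the columns of [U], with the sum split at [i]. *)
Lemma Uprev_Ucompl_resolution : Up *m (Up^t* *m S) + Uc *m (Uc^t* *m S) = 1%:M.
Proof.
rewrite -(eigensystem_resolution hU) !mulmxA -mulmxDl; congr (_ *m S).
apply/matrixP => a b; rewrite !mxE.
rewrite (reindex (cast_ord (subnKC (ltnW (ltn_ord i))))) /=; last first.
  by exists (cast_ord (esym (subnKC (ltnW (ltn_ord i))))) => k _; rewrite ?cast_ordK ?cast_ordKV.
rewrite big_split_ord /=; congr (_ + _); apply: eq_bigr => k _; rewrite !mxE //.
by congr (U a _ * Num.conj (U b _)); apply: val_inj.
Qed.

Lemma Ucompl_expand m (v : 'M[C]_(n, m)) : Up^t* *m S *m v = 0 -> v = Uc *m (Uc^t* *m S *m v).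
Proof.
move=> h; rewrite -[LHS]mul1mx -Uprev_Ucompl_resolution mulmxDl -(mulmxA Up) -(mulmxA Uc) h.
by rewrite mulmx0 add0r.
Qed.

Lemma Ucompl_dotS x y : dot (Uc *m x) (S *m (Uc *m y)) = dot x y.
Proof. by rewrite dot_adjl !mulmxA Ucompl_gram mul1mx. Qed.

Lemma Ucompl_dotH x y :
  dot (Uc *m x) (H *m (Uc *m y)) = dot x (diagC (fun k => lam (emb k)) *m y).
Proof. by rewrite dot_adjl (mulmxA H) Ucompl_mul !mulmxA Ucompl_gram mul1mx. Qed.

Lemma residual_Ucompl (mu : R) (x : 'cV[C]_(n - i)) :
  residual H S mu (Uc *m x)
  = S *m (Uc *m (diagC (fun k => lam (emb k)) *m x - mu%:C *: x)).
Proof.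
rewrite /residual (mulmxA H) Ucompl_mul mulmxBr mulmxBr -!scalemxAr.
by rewrite !mulmxA.
Qed.

Lemma enorm_residual (g : 'cV[C]_(n - i)) :
  enorm (invmx S) (S *m (Uc *m g)) = Num.sqrt (dot g g).
Proof. by rewrite enormE mulKmx ?(hpd_unit hS) // dotC Ucompl_dotS. Qed.

(** The search direction [p] differs from [- Uc (K^c g)] only by a combination of the deflated
    eigenvectors, which the trial basis can cancel. *)
Lemma trial_basis_descent_direction (K : 'M[C]_n) (mu t : R) (x : 'cV[C]_(n - i)) :
  let g := diagC (fun k => lam (emb k)) *m x - mu%:C *: x in
  exists y, trial_basis i H S K U mu (Uc *m x) *m y
            = Uc *m (x - t%:C *: (Kcompl i S U K *m g)).
Proof.
move=> g; rewrite /trial_basis residual_Ucompl -/g.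
set p := - (K *m _).
(* The weights are 1 on the iterate and [t] on [p]; those on [Up] remove the component of [t p]
   along it. *)
exists (col_mx (- t%:C *: (Up^t* *m S *m p)) (col_mx 1%:M (t%:C)%:M)).
have pE : p = Up *m (Up^t* *m S *m p) - Uc *m (Kcompl i S U K *m g).
  rewrite -[LHS]mul1mx -Uprev_Ucompl_resolution mulmxDl -(mulmxA Up) -(mulmxA Uc); congr (_ + _).
  by rewrite /p /Kcompl !mulmxN !mulmxA.
move: (Kcompl i S U K *m g) pE => w pE.
rewrite !mul_row_col mulmx1 mul_mx_scalar -scalemxAr {2}pE -/Up.
by rewrite [in RHS]mulmxBr -[in RHS]scalemxAr scalerBr scaleNr addrCA addKr.
Qed.

End Complement.

(** * Invariants and optimality of the iterates *)

Section Run.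
Local Open Scope sesquilinear_scope.
Variables (R : realType) (n : nat).
Local Notation C := R[i].
Variables (H S : 'M[C]_n) (lam : 'I_n -> R) (U : 'M[C]_n) (i : 'I_n).
Variables (K : nat -> 'M[C]_n) (lamj : nat -> R) (u : nat -> 'cV[C]_n).
Hypotheses (hH : H \is hermsymmx) (hS : hpd S) (hU : eigensystem H S lam U).
Hypothesis hlam : forall k : 'I_n, (k < i)%N -> lam k < lam i.
Hypothesis hrun : psd_id i H S U K lamj u.

Lemma psd_id_optimal j (y : 'cV[C]_(i + (1 + 1)))
    (z := trial_basis i H S (K j) U (lamj j) (u j) *m y) :
  (Uprev i U)^t* *m S *m z = 0 ->
  lamj j.+1 * dot z (S *m z) <= dot z (H *m z).
Proof.
have [_ _ _ /(_ j) [rZ [w [[th [W [hW <- _]]] _]]]] := hrun.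
exact: (ritz_optimal (p := 1) erefl rZ erefl erefl (hermE hH) hS hU hlam hW).
Qed.

(** Every iterate after the initial one is a Ritz vector, which has the three properties by itself,
    so a case distinction on [j] suffices. *)
Lemma psd_id_iterate j :
  [/\ (Uprev i U)^t* *m S *m u j = 0, dot (u j) (S *m u j) = 1
    & dot (u j) (H *m u j) = lamj j].
Proof.
have [up0 un0 ur0 step] := hrun.
case: j => [|j].
  have uSu : dot (u 0%N) (S *m u 0%N) = 1.
    have d0 := hpd_dot_ge0 (u 0%N) hS.
    by rewrite -[LHS](sqr_sqrtr d0) -enormE un0 expr1n.
  split=> //; move: ur0 uSu; rewrite /rayleigh /dot !mulmxA => ur0 uSu.
  have u0 : u 0%N != 0.
    by apply/eqP => u0; move: uSu; rewrite u0 mulmx0 mxE /= => /eqP; rewrite eq_sym oner_eq0.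
  (* [enorm] sees only the real part of the form; positive definiteness of [S] supplies the zero
     imaginary part, so the denominator of [rayleigh] is exactly 1. *)
  have := hS.2 _ u0; rewrite ltcE /= => /andP[/eqP im0 _].
  have uSu1 : ((u 0%N)^t* *m S *m u 0%N) 0 0 = 1.
    by apply/eqP; rewrite eq_complex uSu im0 !eqxx.
  by move: ur0; rewrite uSu1 divr1 => <-.
have [rZ [w [[th [W [hW <- <-]]] ->]]] := step j.
split.
- exact: (ritz_vector_deflated (p := 1) erefl rZ erefl erefl (hermE hH) hS hU hlam hW
    (l0 := ord0) erefl).
- exact: (ritz_vector_dotS (p := 1) erefl hW).
- exact: (ritz_vector_dotH (p := 1) erefl erefl hW).
Qed.

Let d (k : 'I_(n - i)) := lam (cast_ord (subnKC (ltnW (ltn_ord i))) (rshift i k)).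
Let x j := (Ucompl i U)^t* *m S *m u j.

Lemma psd_id_Ucompl j : u j = Ucompl i U *m x j.
Proof. by apply: Ucompl_expand hU _ _ _; case: (psd_id_iterate j). Qed.

Lemma psd_id_dotS j : dot (x j) (x j) = 1.
Proof.
by have [_ <- _] := psd_id_iterate j; rewrite psd_id_Ucompl (Ucompl_dotS hU).
Qed.

Lemma psd_id_dotH j : dot (x j) (diagC d *m x j) = lamj j.
Proof.
by have [_ _ <-] := psd_id_iterate j; rewrite psd_id_Ucompl (Ucompl_dotH hU).
Qed.

(** The test vector lies in the trial space and, being in the span of [Ucompl i U], is deflated. So
    the minimality of the Ritz value applies to it. *)
Lemma psd_id_descent j (t : R)
    (p := Kcompl i S U (K j) *m (diagC d *m x j - (lamj j)%:C *: x j)) :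
  lamj j.+1 * dot (x j - t%:C *: p) (x j - t%:C *: p)
  <= dot (x j - t%:C *: p) (diagC d *m (x j - t%:C *: p)).
Proof.
have [y] := trial_basis_descent_direction hU (K j) (lamj j) t (x j).
rewrite -psd_id_Ucompl => yE; have := @psd_id_optimal j y; cbv zeta.
rewrite yE (Ucompl_dotS hU) (Ucompl_dotH hU); apply.
by rewrite mulmxA (Uprev_Ucompl_gram i hU) mul0mx.
Qed.

End Run.

(** * Convergence of the Ritz values, the residuals and the iterates *)

Theorem theorem3p1 (R : realType) (n : nat) (H S : 'M[R[i]]_n)
    (lam : 'I_n -> R) (U : 'M[R[i]]_n)
    (i : 'I_n) (hi : (i.+1 < n)%N)
    (K : nat -> 'M[R[i]]_n) (lamj : nat -> R) (u : nat -> 'cV[R[i]]_n)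
    (q : R)
    (hH : H \is hermsymmx) (hS : hpd S)
    (hU : eigensystem H S lam U)
    (hprev : forall k : 'I_n, k.+1 = i -> lam k < lam i)
    (hnext : lam i < lam (Ordinal hi))
    (hrun : psd_id i H S U K lamj u)
    (h0 : lam i < lamj 0%N < lam (Ordinal hi))
    (hK : forall j, eff_posdef i S U (K j))
    (hq : ereal_sup [set (cond2 (Kcompl i S U (K j)))%:E | j in [set: nat]]
          = q%:E) :
  lamj @ \oo --> lam i /\
  ((fun j => enorm (invmx S) (residual H S (lamj j) (u j))) @ \oo --> (0 : R)
   /\ converges_directionally u (col i U)).
Proof.
(* [hprev] concerns only the index just before [i]; the ordering of [lam] extends it to all smaller
   ones. *)
have hlam (k : 'I_n) : (k < i)%N -> lam k < lam i.
  move=> ki; have i1 : (i.-1 < n)%N by apply: leq_ltn_trans (leq_pred _) (ltn_ord i).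
  apply: le_lt_trans (hprev (Ordinal i1) _); last by rewrite /= (ltn_predK ki).
  by case: hU => _ _; apply; rewrite /= -ltnS (ltn_predK ki).
have [_ _ mono] := hU.
set d := fun k : 'I_(n - i) => lam (cast_ord (subnKC (ltnW (ltn_ord i))) (rshift i k)).
pose x j := map_mx Num.conj (Ucompl i U)^T *m S *m u j.
have uE : forall j, u j = Ucompl i U *m x j := psd_id_Ucompl hH hS hU hlam hrun.
have xx : forall j, dot (x j) (x j) = 1 := psd_id_dotS hH hS hU hlam hrun.
have xDx : forall j, dot (x j) (diagC d *m x j) = lamj j := psd_id_dotH hH hS hU hlam hrun.
have xE := psd_id_descent hH hS hU hlam hrun; cbv zeta in xE.
have ni : (0 < n - i)%N by rewrite subn_gt0.
have last_n : (n.-1 < n)%N by rewrite ltn_predL (leq_trans _ hi).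
pose lamn := lam (Ordinal last_n).
have d_le k : d k <= lamn by apply: mono; rewrite -ltnS (ltn_predK hi).
(* Position 0 of the complement is position [i] of the whole spectrum. *)
pose k0 : 'I_(n - i) := Ordinal ni.
have dk0 : d k0 = lam i by congr lam; apply: val_inj; rewrite /= addn0.
have le_d k : d k0 <= d k by rewrite dk0; apply: mono; rewrite /= leq_addr.
have lt_d k : k != k0 -> lam (Ordinal hi) <= d k.
  move=> kk0; apply: mono; rewrite /= -[X in (X < _)%N]addn0 ltn_add2l lt0n.
  exact: kk0.
have sum1 j : \sum_k sqn (x j k 0) = 1 by rewrite -dotE.
have mu_ge j : lam i <= lamj j.
  rewrite -(xDx j) dot_diagC -[leLHS]mulr1 -(sum1 j) mulr_sumr ler_sum // => k _.
  by rewrite ler_wpM2r ?sqn_ge0 // -dk0.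
have mu_le j : lamj j <= lamn.
  rewrite -(xDx j) dot_diagC -[leRHS]mulr1 -(sum1 j) mulr_sumr ler_sum // => k _.
  by rewrite ler_wpM2r ?sqn_ge0.
have mudec j : lamj j.+1 <= lamj j.
  by have := xE j 0; rewrite (_ : 0%:C = 0 :> R[i]) // scale0r subr0 xx xDx mulr1.
(* The spread of the undeflated eigenvalues, positive by [hnext]. *)
pose L := lamn - lam i.
have L0 : 0 < L.
  rewrite subr_gt0; apply: lt_le_trans hnext (mono _ _ _).
  by rewrite /= -ltnS (ltn_predK hi).
pose g j := diagC d *m x j - (lamj j)%:C *: x j.
have gdec j : dot (g j) (g j) <= 4 * L * q ^+ 2 * (lamj j - lamj j.+1).
  apply: (step_decrease (diagC_adj d) (hK j) L0 _ (xx j) (xDx j) _ _ (xE j)).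
  - rewrite -lee_fin -hq; apply: ereal_sup_ubound; by exists j.
  (* Both [d k] and [lamj j] lie between [lam i] and [lamn], hence at distance at most [L]. *)
  - rewrite dot_shifted_diagC -[leRHS]mulr1 -(sum1 j) mulr_sumr ler_sum // => k _.
    rewrite ler_wpM2r ?sqn_ge0 //.
    have := d_le k; have := le_d k; have := mu_ge j; have := mu_le j.
    rewrite /L dk0; move: (d k) (lamj j) => e f h1 h2 h3 h4.
    by rewrite -subr_ge0 subr_sqr mulr_ge0 //; lra.
  - move=> y; rewrite dot_diagC dotE !mulr_sumr -sumrB ler_sum // => k _.
    rewrite -mulrBl ler_wpM2r ?sqn_ge0 // /L lerB //; exact: d_le.
have /andP[_ mu0] := h0.
have [mu_cvg g_cvg [c c1 c_cvg]] :=
  convergence_of_decrease xx xDx mudec gdec le_d lt_d mu0.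
rewrite -dk0; split=> //; split.
  have -> : (fun j => enorm (invmx S) (residual H S (lamj j) (u j)))
      = (fun j => Num.sqrt (dot (g j) (g j))).
    by apply/funext => j; rewrite uE (residual_Ucompl hU) (enorm_residual hS hU).
  rewrite -sqrtr0; apply: continuous_cvg g_cvg; exact: sqrt_continuous.
exists c; split=> //.
(* [col i U] is the image of [delta_mx k0 0] under [Ucompl i U], so with the same phases the squared
   distance grows at most by the factor [B]. *)
have [B B0 hB] := dot_mulmx_bounded (Ucompl i U).
apply: cvg_dot_sub0.
have cvB : (fun j => B * dot (c j *: x j - delta_mx k0 0) (c j *: x j - delta_mx k0 0))
    @ \oo --> (0 : R).
  by rewrite -(mulr0 B); apply: cvgMr.
apply: (squeeze_cvgr _ (cvg_cst 0) cvB).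
near=> j; rewrite dot_ge0 /=.
have -> : c j *: u j - col i U = Ucompl i U *m (c j *: x j - delta_mx k0 0).
  rewrite mulmxBr -scalemxAr -uE -colE; congr (_ - _).
  by apply/colP => a; rewrite !mxE; congr (U a _); apply: val_inj; rewrite /= addn0.
exact: hB.
Unshelve. all: by end_near. Qed.
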